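(* Let $M$ be a lattice of rank $d$, let $\Lambda\subset M$ be a finitely generated semigroup with $\mathbb{Z}\Lambda=M$ and such that the cone $\mathbb{R}_{\ge0}\Lambda$ is strictly convex of dimension $d$. Let $\alpha_1,\dots,\alpha_m\in\Lambda\setminus\{0\}$ generate $\Lambda$, let $n_1,\dots,n_p\in\mathbb{Z}^m$ be nonzero vectors in $\ker\psi$ such that the binomials $h_i=U^{n_i^+}-U^{n_i^-}$, $i=1,\dots,p$, generate the ideal of the embedding $Z^\Lambda\hookrightarrow\mathbb{C}^m$, and let $R$ be the $p\times m$ matrix whose $i$th row is $n_i$. For $1\le j_1<\cdots<j_d\le m$ and $1\le i_1<\cdots<i_{m-d}\le p$ set $$m_{j_1,\dots,j_d}^{i_1,\dots,i_{m-d}}:=\psi(n_{i_1}^+)+\cdots+\psi(n_{i_{m-d}}^+)-\sum_{j\in\{1,\dots,m\}\setminus\{j_1,\dots,j_d\}}\alpha_j .$$ Then the Jacobian ideal $\mathrm{Jac}(Z^\Lambda)$ of the toric variety $Z^\Lambda$ is the monomial ideal of $\mathbb{C}[\Lambda]$ generated by the monomials $X^{m_{j_1,\dots,j_d}^{i_1,\dots,i_{m-d}}}$ for all $1\le j_1<\cdots<j_d\le m$ and $1\le i_1<\cdots<i_{m-d}\le p$ such that $\alpha_{j_1}\wedge\cdots\wedge\alpha_{j_d}\ne0$ and the submatrix of $R$ formed by the rows $i_1,\dots,i_{m-d}$ has rank $m-d$.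
   Context: $\mathbb{C}[\Lambda]=\{\sum_{\text{finite}}a_\lambda X^\lambda\mid\lambda\in\Lambda,\ a_\lambda\in\mathbb{C}\}$ is the semigroup algebra and $Z^\Lambda=\mathrm{Spec}\,\mathbb{C}[\Lambda]$. $\psi:\mathbb{Z}^m\to M$ is the homomorphism sending the $j$th canonical vector to $\alpha_j$. The embedding $Z^\Lambda\hookrightarrow\mathbb{C}^m$ is given by the surjection $\psi_*:\mathbb{C}[U_1,\dots,U_m]\to\mathbb{C}[\Lambda]$, $U_j\mapsto X^{\alpha_j}$. For $v\in\mathbb{Z}^m$, write $v=v^+-v^-$ uniquely with $v^\pm\in\mathbb{Z}^m_{\ge0}$ of disjoint support. The wedge product is in $\bigwedge^dM$. The Jacobian ideal $\mathrm{Jac}(Z^\Lambda)\subset\mathbb{C}[\Lambda]$ is the ideal generated by the minors of order $m-d$ of the $p\times m$ matrix $\left(\psi_*(\partial h_i/\partial U_j)\right)$. *)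

(* Defs.v *)
From HB Require Import structures.
From mathcomp Require Import all_boot all_order all_algebra.
From mathcomp Require Import generic_quotient ring_quotient.
From mathcomp Require Import boolp reals.
From mathcomp Require Import complex.
From mathcomp Require Import freeg mpoly.
From mathcomp Require Import zify.

Set Implicit Arguments.
Unset Strict Implicit.
Unset Printing Implicit Defensive.

Import Order.TTheory GRing.Theory Num.Theory.

Local Open Scope ring_scope.
Local Open Scope quotient_scope.

Definition Zspan (V : zmodType) (P : V -> Prop) (x : V) : Prop :=
  exists s : seq (int * V),
    (forall t, t \in s -> P t.2) /\ x = \sum_(t <- s) t.2 *~ t.1.

Definition ideal_gen (A : comNzRingType) (P : A -> Prop) (x : A) : Prop :=
  exists s : seq (A * A),
    (forall t, t \in s -> P t.2) /\ x = \sum_(t <- s) t.1 * t.2.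

Definition increasing (k n : nat) (f : 'I_k -> 'I_n) : Prop :=
  forall a b : 'I_k, (a < b)%N -> (f a < f b)%N.

(* The d-th exterior power of M: the free abelian group on M^d modulo the
   subgroup generated by additivity in each slot and by the tuples with a
   repeated entry. *)
Section ExteriorPower.
Variables (d : nat) (M : zmodType).

Let free := {freeg {ffun 'I_d -> M} / int}.

Definition set_slot (v : {ffun 'I_d -> M}) (i : 'I_d) (x : M) :
    {ffun 'I_d -> M} :=
  [ffun j => if j == i then x else v j].

Inductive ext_rel : free -> Prop :=
| ext_rel_add (v : {ffun 'I_d -> M}) (i : 'I_d) (x y : M) :
    ext_rel (<< set_slot v i (x + y) >>
             - << set_slot v i x >> - << set_slot v i y >>)
| ext_rel_alt (v : {ffun 'I_d -> M}) (i j : 'I_d) :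
    i != j -> v i = v j -> ext_rel << v >>.

Definition ext_sub : {pred free} := [pred f | `[< Zspan ext_rel f >]].

Lemma ext_sub_zmod_closed : zmod_closed ext_sub.
Proof.
split=> [|f g /asboolP [s [sP ->]] /asboolP [t [tP ->]]]; apply/asboolP.
  by exists [::]; split=> //; rewrite big_nil.
exists (s ++ [seq (- u.1, u.2) | u <- t]); split=> [u|].
  by rewrite mem_cat => /orP [/sP //|/mapP [w /tP wP ->]].
rewrite big_cat big_map /=; congr (_ + _).
by rewrite -sumrN; apply: eq_bigr => u _; rewrite mulrNz.
Qed.

HB.instance Definition _ :=
  GRing.isZmodClosed.Build free ext_sub ext_sub_zmod_closed.

Definition extpow : zmodType := Quotient.quot ext_sub.

Definition wedge (v : 'I_d -> M) : extpow := \pi_extpow << finfun v >>.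

End ExteriorPower.

(* The semigroup algebra K[S], for a commutative semigroup with zero S written
   additively: the finitely supported functions S -> K under convolution. *)
Definition semialg (K : comNzRingType) (S : nmodType) : Type := {freeg S / K}.

Section SemigroupAlgebra.
Variables (K : comNzRingType) (S : nmodType).

Local Notation A := (semialg K S).

HB.instance Definition _ := GRing.Lmodule.copy A {freeg S / K}.

Definition Xpow (x : S) : A := << x >>.

Definition salg_mul (f g : A) : A :=
  \sum_(x <- dom f) \sum_(y <- dom g)
    << coeff x f * coeff y g *g x + y >>.

Fact salg_scaleU (c c' : K) (x : S) :
  c *: (<< c' *g x >> : A) = << c * c' *g x >>.
Proof.
apply/eqP/freeg_eqP => y.
by rewrite [LHS]coeffZ !coeffU mulrA.
Qed.

HB.instance Definition _ (V : lmodType K) (h : S -> V) :=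
  GRing.isZmodMorphism.Build {freeg S / K} V (fglift h) (lift_is_additive h).

Fact salg_fgliftE (V : lmodType K) (h : S -> V) (f : A) :
  fglift h f = \sum_(x <- dom f) coeff x f *: h x.
Proof.
rewrite -[in LHS](freeg_sumE f) raddf_sum.
by apply: eq_bigr => x _; rewrite /= liftU.
Qed.

Fact salg_mulE (f g : A) :
  salg_mul f g =
  fglift (fun x => fglift (fun y => << x + y >> : A) g) f.
Proof.
rewrite salg_fgliftE; apply: eq_bigr => x _.
rewrite salg_fgliftE scaler_sumr; apply: eq_bigr => y _.
by rewrite !salg_scaleU mulr1.
Qed.

Fact salg_mulC : commutative salg_mul.
Proof.
move=> f g; rewrite /salg_mul exchange_big /=.
by apply: eq_bigr => y _; apply: eq_bigr => x _; rewrite mulrC addrC.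
Qed.

Fact salg_mulDl : left_distributive salg_mul +%R.
Proof. by move=> f g h; rewrite !salg_mulE raddfD. Qed.

Fact salg_mulDr : right_distributive salg_mul +%R.
Proof. by move=> f g h; rewrite !(salg_mulC f) salg_mulDl. Qed.

Fact salg_mul0l : left_zero 0 salg_mul.
Proof. by move=> f; rewrite salg_mulE raddf0. Qed.

Fact salg_mul0r : right_zero 0 salg_mul.
Proof. by move=> f; rewrite salg_mulC salg_mul0l. Qed.

Fact salg_mulUU (a b : K) (x y : S) :
  salg_mul << a *g x >> << b *g y >> = << a * b *g x + y >>.
Proof. by rewrite salg_mulE !liftU !salg_scaleU mulr1. Qed.

Fact salg_mul1l : left_id (Xpow 0) salg_mul.
Proof.
move=> f; rewrite salg_mulE liftU scale1r salg_fgliftE -[RHS]freeg_sumE.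
by apply: eq_bigr => x _; rewrite salg_scaleU mulr1 add0r.
Qed.

Fact salg_mulA : associative salg_mul.
Proof.
have suml (I : Type) (r : seq I) (F : I -> A) (g : A) :
    salg_mul (\sum_(i <- r) F i) g = \sum_(i <- r) salg_mul (F i) g.
  exact: (big_morph (salg_mul^~ g) (fun f h => salg_mulDl f h g) (salg_mul0l g)).
have sumr (I : Type) (r : seq I) (F : I -> A) (g : A) :
    salg_mul g (\sum_(i <- r) F i) = \sum_(i <- r) salg_mul g (F i).
  by rewrite salg_mulC suml; apply: eq_bigr => i _; rewrite salg_mulC.
move: salg_mul salg_mulUU suml sumr => mul mulUU suml sumr f g h.
rewrite -(freeg_sumE f) !suml; apply: eq_bigr => x _.
rewrite -(freeg_sumE g) suml !sumr suml; apply: eq_bigr => y _.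
rewrite -(freeg_sumE h) !sumr; apply: eq_bigr => z _.
by rewrite !mulUU mulrA addrA.
Qed.

Fact salg_oner_neq0 : Xpow 0 != 0.
Proof. by rewrite freegU_eq0 oner_eq0. Qed.

HB.instance Definition _ := GRing.Zmodule_isComNzRing.Build A
  salg_mulA salg_mulC salg_mul1l salg_mulDl salg_oner_neq0.

Fact salg_scaleAl (c : K) (f g : A) : c *: (f * g) = c *: f * g.
Proof.
have fgliftZ (V : lmodType K) (h : S -> V) : fglift h (c *: f) = c *: fglift h f.
  rewrite -[in LHS](freeg_sumE f) scaler_sumr raddf_sum salg_fgliftE scaler_sumr.
  by apply: eq_bigr => x _; rewrite salg_scaleU /= liftU scalerA.
by rewrite /GRing.mul /= !salg_mulE fgliftZ.
Qed.

HB.instance Definition _ := GRing.Lmodule_isLalgebra.Build K A salg_scaleAl.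
HB.instance Definition _ := GRing.Lalgebra_isComAlgebra.Build K A.

Lemma XpowD (x y : S) : Xpow (x + y) = Xpow x * Xpow y.
Proof. by rewrite [RHS]salg_mulUU mulr1. Qed.

End SemigroupAlgebra.

Section LatticeSemigroup.
Variables (M : zmodType) (L : addrClosed M).

Definition subsg : Type := {x : M | x \in L}.

HB.instance Definition _ := SubChoice.copy subsg {x : M | x \in L}.
HB.instance Definition _ :=
  GRing.SubChoice_isSubNmodule.Build M _ subsg (rpred0D L).

End LatticeSemigroup.

(* For a lattice M with coordinates phi : M ~ Z^d, the space M_R = M (x) R is
   identified with R^d through phi. *)
Definition cone (R : realType) (d : nat) (M : zmodType)
    (phi : M -> 'rV[int]_d) (L : {pred M}) (v : 'rV[R]_d) : Prop :=
  exists s : seq (R * M),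
    (forall t, t \in s -> 0 <= t.1 /\ t.2 \in L) /\
    v = \sum_(t <- s) t.1 *: map_mx intr (phi t.2).

Definition strictly_convex (R : realType) (d : nat) (sigma : 'rV[R]_d -> Prop) :
    Prop :=
  forall v, sigma v -> sigma (- v) -> v = 0.

(* The dimension of a cone is the dimension of its linear span. *)
Definition cone_has_dim (R : realType) (d : nat) (sigma : 'rV[R]_d -> Prop)
    (k : nat) : Prop :=
  exists V : {vspace 'rV[R]_d},
    [/\ forall v, sigma v -> v \in V,
        forall W : {vspace 'rV[R]_d},
          (forall v, sigma v -> v \in W) -> (V <= W)%VS
      & \dim V = k].

Definition psi (m : nat) (M : zmodType) (alpha : 'I_m -> M) (v : 'rV[int]_m) :
    M :=
  \sum_(j < m) alpha j *~ v 0 j.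

Definition pos_part (m : nat) (v : 'rV[int]_m) : 'rV[int]_m :=
  \row_j Num.max (v 0 j) 0.

Definition neg_part (m : nat) (v : 'rV[int]_m) : 'rV[int]_m :=
  \row_j Num.max (- v 0 j) 0.

Lemma pos_neg_partK (m : nat) (v : 'rV[int]_m) : v = pos_part v - neg_part v.
Proof. by apply/rowP => j; rewrite !mxE; lia. Qed.

Lemma pos_neg_part_disjoint (m : nat) (v : 'rV[int]_m) (j : 'I_m) :
  pos_part v 0 j = 0 \/ neg_part v 0 j = 0.
Proof. by rewrite !mxE; lia. Qed.

(* U^w for w with nonnegative entries. *)
Definition Umon (K : comNzRingType) (m : nat) (w : 'rV[int]_m) : {mpoly K[m]} :=
  'X_[ [multinom absz (w ord0 j) | j < m] ].

Definition binomial_of (K : comNzRingType) (m : nat) (v : 'rV[int]_m) :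
    {mpoly K[m]} :=
  Umon K (pos_part v) - Umon K (neg_part v).

Definition psi_star (K : comNzRingType) (S : nmodType) (m : nat)
    (alpha : 'I_m -> S) (f : {mpoly K[m]}) : semialg K S :=
  mmap (GRing.in_alg (semialg K S)) (fun j => Xpow K (alpha j)) f.

Lemma psi_starX (K : comNzRingType) (S : nmodType) (m : nat)
    (alpha : 'I_m -> S) (j : 'I_m) :
  psi_star alpha 'X_j = Xpow K (alpha j).
Proof. by rewrite /psi_star mmapX mmap1U. Qed.

Definition jacobian_mx (K : comNzRingType) (S : nmodType) (m p : nat)
    (alpha : 'I_m -> S) (h : 'I_p -> {mpoly K[m]}) : 'M[semialg K S]_(p, m) :=
  \matrix_(i < p, j < m) psi_star alpha (mderiv j (h i)).

Definition Jac (K : comNzRingType) (S : nmodType) (d m p : nat)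
    (alpha : 'I_m -> S) (h : 'I_p -> {mpoly K[m]}) : semialg K S -> Prop :=
  ideal_gen (fun g => exists (I : 'I_(m - d) -> 'I_p) (J : 'I_(m - d) -> 'I_m),
    [/\ increasing I, increasing J
      & g = \det (mxsub I J (jacobian_mx alpha h))]).

(* The exponent m_{j_1,...,j_d}^{i_1,...,i_{m-d}}, as an element of M. *)
Definition jac_exp (d m p : nat) (M : zmodType) (alpha : 'I_m -> M)
    (n : 'I_p -> 'rV[int]_m) (J : 'I_d -> 'I_m) (I : 'I_(m - d) -> 'I_p) : M :=
  \sum_(k < m - d) psi alpha (pos_part (n (I k)))
  - \sum_(j < m | j \notin codom J) alpha j.

Definition jac_index (d m p : nat) (M : zmodType) (alpha : 'I_m -> M)
    (n : 'I_p -> 'rV[int]_m) (J : 'I_d -> 'I_m) (I : 'I_(m - d) -> 'I_p) :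
    Prop :=
  [/\ increasing J, increasing I, wedge (fun k => alpha (J k)) != 0
    & \rank (map_mx (intr : int -> rat) (rowsub I (\matrix_(i < p) n i)))
      = (m - d)%N].

(* Main.v *)
(* Multiplying the column j of the Jacobian matrix by X^alpha_j turns its (i, j)
   entry into n_ij X^psi(n_i^+), because psi(n_i^+) = psi(n_i^-).  Hence a minor
   on the rows I and the columns J' satisfies
     X^(sum_J' alpha_j) * minor = det(R_IJ') X^(sum_I psi(n_i^+)),
   and since monomials are not zero divisors, the minor is either 0 or a nonzero
   multiple of the monomial X^(m_J^I), J being the complement of J'.  The rows
   of R lie in the kernel of the rank d matrix A of the alpha_j, so complementary
   minors vanish together: det(R_IJ') <> 0 iff R_I has rank m - d and
   det(A_J) <> 0, and the latter says that the wedge of the alpha_j, j in J, is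
   nonzero. *)
Require Import Defs.
From HB Require Import structures.
From mathcomp Require Import all_boot all_order all_algebra.
From mathcomp Require Import perm.
From mathcomp Require Import boolp reals.
From mathcomp Require Import complex.
From mathcomp Require Import freeg mpoly.
From mathcomp Require Import generic_quotient ring_quotient.
From mathcomp Require Import zify.

Set Implicit Arguments.
Unset Strict Implicit.
Unset Printing Implicit Defensive.

Import Order.TTheory GRing.Theory Num.Theory.

Local Open Scope ring_scope.

(** * Ideals given by generators *)

Section IdealGen.
Variable A : comNzRingType.
Implicit Types (P Q : A -> Prop) (x y : A).

Lemma ideal_gen0 P : ideal_gen P 0.
Proof. by exists [::]; split=> //; rewrite big_nil. Qed.

Lemma ideal_gen_mull P x y : P y -> ideal_gen P (x * y).
Proof.
move=> Py; exists [:: (x, y)]; split; last by rewrite big_seq1.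
by move=> t; rewrite inE => /eqP ->.
Qed.

Lemma ideal_genD P x y : ideal_gen P x -> ideal_gen P y -> ideal_gen P (x + y).
Proof.
move=> [s [sP ->]] [t [tP ->]]; exists (s ++ t); split; last by rewrite big_cat.
by move=> u; rewrite mem_cat => /orP[/sP|/tP].
Qed.

Lemma ideal_genM P x y : ideal_gen P y -> ideal_gen P (x * y).
Proof.
move=> [s [sP ->]]; exists [seq (x * t.1, t.2) | t <- s]; split.
  by move=> u /mapP[t /sP Pt ->].
by rewrite big_map mulr_sumr; apply: eq_bigr => t _; rewrite mulrA.
Qed.

Lemma ideal_gen_sub P Q :
  (forall x, P x -> ideal_gen Q x) -> forall x, ideal_gen P x -> ideal_gen Q x.
Proof.
move=> PQ x [s [sP ->]]; rewrite big_seq.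
elim/big_ind: _ => [|y z|t /sP /PQ]; [exact: ideal_gen0|exact: ideal_genD|].
exact: ideal_genM.
Qed.

End IdealGen.

(** * Increasing index maps and their complements *)

Lemma increasing_inj (k n : nat) (f : 'I_k -> 'I_n) :
  increasing f -> injective f.
Proof.
move=> fI a b fab; apply: val_inj; apply/eqP; rewrite eqn_leq.
by apply/andP; split; rewrite leqNgt; apply/negP => /fI; rewrite fab ltnn.
Qed.

Lemma increasing_enum (n k : nat) (S : {set 'I_n}) :
  #|S| = k -> exists2 f : 'I_k -> 'I_n, increasing f & codom f =i S.
Proof.
move=> <-; exists enum_val => [a b ab|i].
  (* The index [a] yields an element of ['I_n], which serves as the default value of [nth]. *)
  have n_gt0 : 'I_n := enum_val a.
  rewrite !(enum_val_nth n_gt0).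
  (* [enum S] is a filtered sublist of the increasing list of all ordinals. *)
  have srt : sorted (fun i j : 'I_n => (i < j)%N) (enum S).
    rewrite /enum_mem sorted_filter //; first by move=> x y z; apply: ltn_trans.
    by have := iota_ltn_sorted 0 n; rewrite -val_enum_ord sorted_map enumT.
  apply: (sorted_ltn_nth (leT := fun i j : 'I_n => (i < j)%N)) => //.
  - by move=> x y z; apply: ltn_trans.
  - by rewrite inE -cardE.
  - by rewrite inE -cardE.
apply/codomP/idP => [[j ->]|iS]; first exact: enum_valP.
by exists (enum_rank_in iS i); rewrite enum_rankK_in.
Qed.

Lemma increasing_compl (n k : nat) (f : 'I_k -> 'I_n) :
  increasing f ->
  exists2 g : 'I_(n - k) -> 'I_n, increasing g
    & forall i, (i \in codom g) = (i \notin codom f).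
Proof.
move=> fI.
have [|g gI gE] := @increasing_enum n (n - k) [set i | i \notin codom f].
  have := cardC (mem (codom f)).
  rewrite (card_codom (increasing_inj fI)) !card_ord cardsE => fC.
  by apply/eqP; rewrite -(eqn_add2l k) fC subnKC // -fC leq_addr.
by exists g => // i; rewrite gE inE.
Qed.

Lemma big_inj_codom (k n : nat) (f : 'I_k -> 'I_n) (V : nmodType)
    (E : 'I_n -> V) :
  injective f -> \sum_(j in codom f) E j = \sum_i E (f i).
Proof.
move=> f_inj; rewrite -big_uniq; first by rewrite big_image.
by rewrite map_inj_uniq ?enum_uniq.
Qed.

(** * Complementary minors of two matrices with zero product *)

Section ComplementaryMinors.
Variables (F : fieldType) (m d k : nat).
Variables (J : 'I_d -> 'I_m) (J' : 'I_k -> 'I_m).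
Hypotheses (J_inj : injective J) (J'_inj : injective J').
Hypothesis (J'E : forall i, (i \in codom J') = (i \notin codom J)).

Lemma big_compl (V : nmodType) (E : 'I_m -> V) :
  \sum_(j | j \notin codom J) E j = \sum_i E (J' i).
Proof.
by rewrite -big_inj_codom //; apply: eq_bigl => i; rewrite -J'E.
Qed.

Lemma big_split_compl (V : nmodType) (E : 'I_m -> V) :
  \sum_j E j = \sum_i E (J i) + \sum_i E (J' i).
Proof.
by rewrite (bigID (mem (codom J))) /= big_compl big_inj_codom.
Qed.

Lemma mulmx_compl (a b : nat) (u : 'M[F]_(a, m)) (A : 'M[F]_(m, b)) :
  u *m A = colsub J u *m rowsub J A + colsub J' u *m rowsub J' A.
Proof.
apply/matrixP => i j; rewrite !mxE big_split_compl.
by congr (_ + _); apply: eq_bigr => l _; rewrite !mxE.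
Qed.

Lemma compl_eq0 (a : nat) (u : 'M[F]_(a, m)) :
  colsub J u = 0 -> colsub J' u = 0 -> u = 0.
Proof.
by move=> u0 u'0; rewrite -[u]mulmx1 mulmx_compl u0 u'0 !mul0mx addr0.
Qed.

Lemma det_neq0P (l : nat) (B : 'M[F]_l) :
  reflect (forall v : 'rV_l, v *m B = 0 -> v = 0) (\det B != 0).
Proof.
rewrite -unitfE -[_ \is a _]/(B \in unitmx) -row_free_unit; apply: (iffP idP).
  by move=> Bf v vB; apply: (row_free_inj Bf); rewrite mul0mx.
move=> Binj; rewrite -kermx_eq0; apply/eqP/row_matrixP => i; rewrite row0.
by apply: Binj; rewrite -row_mul mulmx_ker row0.
Qed.

(** By the rank hypotheses, once [B] has rank [k] its rows span the whole left kernel of [A]. A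
    vector of that kernel supported on [J] is a relation between the rows of [A_J]; written as
    [v *m B], it is also a [v] that kills the columns [J'] of [B]. Each determinant is nonzero
    exactly when such vectors are trivial. *)
Lemma complementary_minor_neq0 (A : 'M[F]_(m, d)) (B : 'M[F]_(k, m)) :
  (d + k = m)%N -> \rank A = d -> B *m A = 0 ->
  (\det (colsub J' B) != 0) = (\det (rowsub J A) != 0) && (\rank B == k).
Proof.
move=> dk rA BA; apply/idP/andP => [/det_neq0P B'inj|[/det_neq0P AJinj rB]].
  have Bf : \rank B == k.
    rewrite -/(row_free B) -kermx_eq0; apply/eqP/row_matrixP => i; rewrite row0.
    by apply: B'inj; rewrite mulmx_colsub -row_mul mulmx_ker row0 mxsub_const.
  split=> //; apply/det_neq0P => w wA.
  (* [u] is [w] placed in the coordinates [J] and extended by zero on [J']. *)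
  pose u := w *m rowsub J 1%:M.
  have uJ : colsub J u = w.
    rewrite -mulmx_colsub -[RHS]mulmx1; congr (_ *m _).
    by apply/matrixP => i j; rewrite !mxE (inj_eq J_inj).
  have uJ' : colsub J' u = 0.
    rewrite -mulmx_colsub -[RHS](mulmx0 _ w); congr (_ *m _).
    apply/matrixP => i j; rewrite !mxE; case: eqP => // Jij.
    by have := J'E (J' j); rewrite codom_f -Jij codom_f.
  have uA : u *m A = 0 by rewrite mulmx_compl uJ uJ' wA mul0mx addr0.
  have BK : (B <= kermx A)%MS by apply/sub_kermxP.
  have /submxP[v uE] : (u <= B)%MS.
    (* The inclusion is an equality because both spaces have dimension [m - d = k]. *)
    have /eqmxP -> : (B == kermx A)%MS.
      rewrite -(geq_leqif (mxrank_leqif_eq BK)).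
      by rewrite mxrank_ker rA (eqP Bf) -dk addKn.
    exact/sub_kermxP.
  have v0 : v = 0 by apply: B'inj; rewrite mulmx_colsub -uE.
  by rewrite -uJ uE v0 mul0mx mxsub_const.
apply/det_neq0P => v vB; apply: (row_free_inj rB); rewrite mul0mx.
(* Now [v *m B] is supported on [J] and killed by [A], so its [J] part is killed by the invertible
   [A_J]. *)
have uJ' : colsub J' (v *m B) = 0 by rewrite -mulmx_colsub.
apply: compl_eq0 => //; apply: AJinj.
have := mulmx_compl (v *m B) A.
by rewrite uJ' mul0mx addr0 -mulmxA BA mulmx0.
Qed.

End ComplementaryMinors.

(** * Alternating multi-additive maps on a group with [d] generators *)

Section AlternatingForm.
Variables (d : nat) (M V : zmodType) (D : {ffun 'I_d -> M} -> V).
Hypothesis D_add : forall (v : {ffun 'I_d -> M}) i x y,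
  D (set_slot v i (x + y)) = D (set_slot v i x) + D (set_slot v i y).
Hypothesis D_alt : forall (v : {ffun 'I_d -> M}) (i j : 'I_d),
  i != j -> v i = v j -> D v = 0.

Lemma set_slot_id (v : {ffun 'I_d -> M}) i : set_slot v i (v i) = v.
Proof. by apply/ffunP => j; rewrite ffunE; case: eqP => // ->. Qed.

(** Polarization: put [v i + v j] in both slots [i] and [j]. The value is 0, and expanding it leaves
    only the two mixed terms. *)
Lemma alternating_tperm (v : {ffun 'I_d -> M}) (i j : 'I_d) :
  i != j -> D [ffun k => v (tperm i j k)] = - D v.
Proof.
move=> ij; pose w x y := set_slot (set_slot v i x) j y.
have wC x y : w x y = set_slot (set_slot v j y) i x.
  apply/ffunP => k; rewrite !ffunE.
  by case: (k =P j) => [->|//]; rewrite eq_sym (negPf ij).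
have w0 x : D (w x x) = 0.
  by apply: (D_alt ij); rewrite !ffunE !eqxx (negPf ij).
have wl x y z : D (w (x + y) z) = D (w x z) + D (w y z) by rewrite !wC D_add.
have := w0 (v i + v j); rewrite wl /w !D_add -/(w _ _).
rewrite -!/(w _ _) !w0 add0r addr0 => /eqP; rewrite addrC addr_eq0 => /eqP.
have -> : w (v i) (v j) = v.
  apply/ffunP => k; rewrite !ffunE.
  by case: eqP => [->//|_]; case: eqP => [->|].
move=> <-; congr D; apply/ffunP => k; rewrite !ffunE.
case: tpermP => [->|->|/eqP/negPf-> /eqP/negPf-> //]; rewrite eqxx //.
by rewrite (negPf ij).
Qed.

(** Only vanishing is transported, so a factorization into transpositions suffices and no sign has
    to be tracked. *)
Lemma alternating_perm0 (s : 'S_d) (v : {ffun 'I_d -> M}) :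
  D v = 0 -> D [ffun k => v (s k)] = 0.
Proof.
have [ts -> /allP ts_ne] := prod_tpermP s.
elim: ts ts_ne v => [|t ts IH] ts_ne v v0.
  rewrite big_nil -[RHS]v0; congr D.
  by apply/ffunP => k; rewrite ffunE perm1.
rewrite big_cons; set s' := (\prod_(_ <- _) _)%g.
have := alternating_tperm [ffun k => v (s' k)] (ts_ne t (mem_head _ _)).
rewrite IH // => [/eqP|u uts]; last by apply: ts_ne; rewrite inE uts orbT.
rewrite oppr0 => /eqP <-; congr D; apply/ffunP => k.
by rewrite !ffunE permM.
Qed.

(** Slots are expanded in the generators [e] one at a time. The induction on [k] treats tuples whose
    slots from [k] on are already generators; [k = d] imposes no condition, and at [k = 0] the tuple
    either repeats an entry or permutes [e]. *)
Lemma alternating_eq0 (e : 'I_d -> M) :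
  (forall x, exists c : 'I_d -> int, x = \sum_j e j *~ c j) ->
  D (finfun e) = 0 -> forall v, D v = 0.
Proof.
move=> e_span De v.
suff: forall k (v : {ffun 'I_d -> M}),
    (forall i : 'I_d, (k <= i)%N -> exists j, v i = e j) -> D v = 0.
  by move=> /(_ d v); apply=> i; rewrite leqNgt ltn_ord.
elim=> [|k IH] {}v vP.
  have /fin_all_exists[f fP] : forall i, exists j, v i = e j.
    by move=> i; apply: vP.
  have [/injectiveP f_inj|/injectivePn[i [j ij fij]]] :=
    boolP (injectiveb (finfun f)).
    rewrite -[RHS](alternating_perm0 (perm f_inj) De); congr D.
    by apply/ffunP => i; rewrite !ffunE permE ffunE fP.
  by apply: (D_alt ij); rewrite !fP; move: fij; rewrite !ffunE => ->.
have [kd|dk] := ltnP k d; last first.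
  by apply: IH => i ki; move: (ltn_ord i); rewrite ltnNge (leq_trans dk ki).
pose i := Ordinal kd; pose f x := D (set_slot v i x).
have f_sub : zmod_morphism f.
  by move=> x y; apply/eqP; rewrite eq_sym subr_eq /f -D_add subrK.
(* As a function of slot [k] alone [D] is additive, so it distributes over the integer combination
   giving [v i]. *)
pose g : {additive M -> V} :=
  HB.pack f (GRing.isZmodMorphism.Build _ _ f f_sub).
have [c vi] := e_span (v i).
rewrite -(set_slot_id v i); change (g (v i) = 0).
rewrite vi raddf_sum big1 // => j _.
rewrite raddfMz (_ : g (e j) = 0) ?mul0rz //; apply: IH => l kl.
rewrite ffunE; case: eqP => [_|li]; first by exists j.
apply: vP; rewrite ltn_neqAle kl andbT; apply/eqP => kl'.
by apply: li; apply: val_inj.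
Qed.

End AlternatingForm.

(** * Nonvanishing of a wedge product detected by a determinant *)

Section Wedge.
Variables (d : nat) (M : zmodType) (phi : {additive M -> 'rV[int]_d}).
Hypothesis phi_bij : bijective phi.

Lemma pi_extpow_eq0 (x : {freeg {ffun 'I_d -> M} / int}) :
  (\pi_(extpow d M)%qT x == 0) = `[< Zspan (@ext_rel d M) x >].
Proof.
have -> : (0 : extpow d M) = \pi_(extpow d M)%qT 0 by rewrite pi_zeror.
by rewrite -Quotient.idealrBE subr0.
Qed.

Lemma ext_rel_pi0 (x : {freeg {ffun 'I_d -> M} / int}) :
  ext_rel x -> \pi_(extpow d M)%qT x = 0.
Proof.
move=> xP; apply/eqP; rewrite pi_extpow_eq0; apply/asboolP.
exists [:: (1, x)]; split; last by rewrite big_seq1.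
by move=> t; rewrite inE => /eqP ->.
Qed.

Lemma wedge_add (v : {ffun 'I_d -> M}) i x y :
  wedge (set_slot v i (x + y))
  = wedge (set_slot v i x) + wedge (set_slot v i y).
Proof.
rewrite /wedge !ffunK.
have := ext_rel_pi0 (ext_rel_add v i x y).
by rewrite !raddfB /= => /eqP; rewrite -addrA -opprD subr_eq0 => /eqP.
Qed.

Lemma wedge_alt (v : {ffun 'I_d -> M}) (i j : 'I_d) :
  i != j -> v i = v j -> wedge v = 0.
Proof.
move=> ij vij; rewrite /wedge ext_rel_pi0 //.
by apply: ext_rel_alt ij _; rewrite !ffunE.
Qed.

Let detphi (v : 'I_d -> M) : int := \det (\matrix_(i < d) phi (v i)).

Lemma detphi_add (v : {ffun 'I_d -> M}) i x y :
  detphi (set_slot v i (x + y))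
  = detphi (set_slot v i x) + detphi (set_slot v i y).
Proof.
have row'E z : row' i (\matrix_(j < d) phi (set_slot v i z j))
    = row' i (\matrix_(j < d) phi (v j)).
  by apply/matrixP => a b; rewrite !mxE ffunE eq_sym (negPf (neq_lift _ _)).
rewrite /detphi (@determinant_multilinear _ _ _
  (\matrix_(j < d) phi (set_slot v i x j))
  (\matrix_(j < d) phi (set_slot v i y j)) i 1 1).
- by rewrite !mul1r.
- by rewrite !scale1r !rowK !ffunE eqxx raddfD.
- by rewrite !row'E.
- by rewrite !row'E.
Qed.

Lemma detphi_alt (v : 'I_d -> M) (i j : 'I_d) :
  i != j -> v i = v j -> detphi v = 0.
Proof.
by move=> ij vij; apply: (determinant_alternate ij) => k; rewrite !mxE vij.
Qed.

(** With [e] the basis of [M] given by [phi], the wedge of [w] is [detphi w] times the wedge of [e].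
    Conversely [detphi] factors through the exterior power. *)
Lemma wedge_neq0 (v : 'I_d -> M) : (wedge v != 0) = (detphi v != 0).
Proof.
have [phi' phi'K phiK] := phi_bij.
apply/idP/idP; apply: contraNN => /eqP v0; apply/eqP.
  pose e j := phi' (delta_mx 0 j).
  (* [D] is alternating and vanishes at [e], where [detphi] is 1; hence it vanishes everywhere. *)
  pose D (w : {ffun 'I_d -> M}) := wedge w - wedge e *~ detphi w.
  have /(_ (finfun v)) : forall w, D w = 0.
    apply: (@alternating_eq0 _ _ _ _ _ _ e).
    - by move=> w i x y; rewrite /D wedge_add detphi_add mulrzDr addrACA opprD.
    - move=> w i j ij wij.
      by rewrite /D (wedge_alt ij wij) (detphi_alt ij wij) mulr0z subrr.
    - move=> x; exists (phi x 0); apply: (bij_inj phi_bij).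
      rewrite raddf_sum [LHS]row_sum_delta; apply: eq_bigr => j _.
      by rewrite raddfMz /= phiK -scaler_int intz.
    rewrite /D (_ : detphi _ = 1).
      by rewrite /wedge ffunK subrr.
    rewrite /detphi -(det1 _ d); congr (\det _); apply/row_matrixP => i.
    by rewrite rowK ffunE phiK row1.
  have vE : detphi (finfun v) = detphi v.
    by congr (\det _); apply/matrixP => i j; rewrite !mxE ffunE.
  by rewrite /D vE v0 mulr0z subr0 /wedge ffunK.
(* Viewing [int] as a module over itself lets [fglift] extend the determinant linearly to the free
   group, where it kills the defining relations. *)
pose h (w : {ffun 'I_d -> M}) : int^o := detphi w.
have h0 x : ext_rel x -> fglift h x = 0.
  case=> [w i a b|w i j ij wij]; last first.
    by rewrite liftU scale1r /h (detphi_alt ij wij).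
  rewrite !raddfB /= !liftU !scale1r /h detphi_add.
  by rewrite -addrA -opprD subrr.
move/eqP: v0; rewrite pi_extpow_eq0 => /asboolP[s [sP sE]].
have : fglift h << finfun v >> = 0.
  rewrite sE raddf_sum big_seq big1 // => t /sP/h0 ht.
  by rewrite raddfMz /= ht mul0rz.
rewrite liftU scale1r /h => <-.
by congr (\det _); apply/matrixP => i j; rewrite !mxE ffunE.
Qed.

End Wedge.

(** * Monomials in the algebra of a cancellative semigroup *)

Section SemigroupAlgebraTheory.
Variables (K : idomainType) (S : nmodType).
Hypothesis S_cancel : right_injective (@GRing.add S).
Local Notation X := (Xpow K).

Lemma XpowME (b : S) (g : semialg K S) :
  X b * g = \sum_(z <- dom g) << coeff z g *g b + z >>.
Proof.
rewrite -[in LHS](freeg_sumE g) mulr_sumr; apply: eq_bigr => z _.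
by rewrite [LHS]salg_mulUU mul1r.
Qed.

Lemma coeff_XpowM (b x : S) (g : semialg K S) :
  coeff (b + x) (X b * g) = coeff x g.
Proof.
rewrite XpowME -[in RHS](freeg_sumE g) !raddf_sum /=.
by apply: eq_bigr => z _; rewrite !coeffU (inj_eq (@S_cancel b)).
Qed.

Lemma XpowM_eq0 (b : S) (g : semialg K S) : X b * g = 0 -> g = 0.
Proof.
move=> bg0; apply/eqP/freeg_eqP => x.
by rewrite -(coeff_XpowM b) bg0 !coeff0.
Qed.

(** The coefficient of [X y] on the left is [c], which is nonzero, so [y] is [b] plus an exponent in
    the support of [g]. This is how a difference of exponents, a priori only in the lattice, is
    shown to lie in the semigroup. *)
Lemma XpowM_eq (b y : S) (c : K) (g : semialg K S) :
  X b * g = c *: X y -> c != 0 -> exists2 l, y = b + l & g = c *: X l.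
Proof.
move=> bg c0; have [l yE] : exists l, y = b + l.
  have : coeff y (X b * g) != 0 by rewrite bg coeffZ coeffU eqxx !mulr1.
  rewrite XpowME raddf_sum /=; apply: contra_neqP => noy.
  rewrite big1 // => z _; rewrite coeffU.
  by case: eqP => [/esym yE|_]; rewrite ?mulr0 //; case: noy; exists z.
exists l => //; apply/eqP; rewrite -subr_eq0; apply/eqP/(@XpowM_eq0 b).
by rewrite mulrBr bg yE XpowD -scalerAr subrr.
Qed.

Lemma Xpow0 : X 0 = 1 :> semialg K S. Proof. by []. Qed.

Lemma Xpow_sum (I : finType) (E : I -> S) : X (\sum_i E i) = \prod_i X (E i).
Proof. exact: (big_morph (@Xpow K S) (@XpowD K S) Xpow0). Qed.

Lemma XpowMn (x : S) k : X (x *+ k) = X x ^+ k.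
Proof. by elim: k => // k IH; rewrite mulrS exprS XpowD IH. Qed.

Variables (m : nat) (alpha : 'I_m -> S).

Lemma psi_star_monomial (c : 'X_{1..m}) :
  psi_star alpha 'X_[c] = X (\sum_j alpha j *+ c j).
Proof.
rewrite /psi_star mmapX /mmap1 Xpow_sum.
by apply: eq_bigr => j _; rewrite XpowMn.
Qed.

(** Image under [psi_star] of the Euler identity for the operator U_j d/dU_j, of which a monomial is
    an eigenvector. *)
Lemma psi_star_mderiv_monomial (c : 'X_{1..m}) (j : 'I_m) :
  X (alpha j) * psi_star alpha (mderiv j 'X_[c])
  = (c j)%:R *: psi_star alpha 'X_[c].
Proof.
rewrite mderivX /psi_star mmapZ -!/(psi_star _ _) mulrCA mulr_algl.
(* When [c j] is 0 the exponent [c - U_(j)] is truncated, but its coefficient is 0. *)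
have [->|cj] := posnP (c j); first by rewrite !scale0r.
congr (_ *: _); rewrite -psi_starX /psi_star -rmorphM /= -mpolyXD.
by rewrite addmC submK // lep1mP -lt0n.
Qed.

End SemigroupAlgebraTheory.

(** * Minors of the Jacobian matrix as multiples of monomials *)

Section JacobianMinors.
Variables (K : numDomainType) (M : zmodType) (Lam : addrClosed M) (m p : nat).
Variables (alpha : 'I_m -> subsg Lam) (n : 'I_p -> 'rV[int]_m).
Hypothesis n_ker : forall i, psi (fun j => val (alpha j)) (n i) = 0.
Local Notation X := (@Xpow K (subsg Lam)).
Local Notation a := (fun j => val (alpha j)).

Lemma subsg_cancel : right_injective (@GRing.add (subsg Lam)).
Proof. by move=> b x y /(congr1 val); rewrite !raddfD /= => /addrI/val_inj. Qed.

(** The element psi(v^+) taken inside the semigroup; [absz] changes nothing, the entries of v^+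
    being nonnegative. *)
Definition psi_pos (v : 'rV[int]_m) : subsg Lam :=
  \sum_j alpha j *+ absz (pos_part v 0 j).

Lemma val_psi_pos v : val (psi_pos v) = psi a (pos_part v).
Proof.
rewrite raddf_sum; apply: eq_bigr => j _.
rewrite raddfMn /= pmulrn; congr (_ *~ _).
by rewrite gez0_abs // mxE le_max lexx orbT.
Qed.

Lemma psi_pos_neg i :
  \sum_j alpha j *+ absz (neg_part (n i) 0 j) = psi_pos (n i).
Proof.
apply: val_inj; rewrite val_psi_pos; apply/esym/eqP; rewrite -subr_eq0.
rewrite -(n_ker i) raddf_sum -sumrB; apply/eqP/eq_bigr => j _.
rewrite raddfMn /= pmulrn -mulrzBr; congr (_ *~ _).
by rewrite !mxE; lia.
Qed.

(** The Euler identity applies to both monomials of h_i. They have the same image, so their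
    exponents at [j] subtract to [n i 0 j]. *)
Lemma jacobian_entry i j :
  X (alpha j) * jacobian_mx alpha (fun i => binomial_of K (n i)) i j
  = X (psi_pos (n i)) *~ n i 0 j.
Proof.
rewrite mxE /binomial_of /Umon mderivB /psi_star mmapB -!/(psi_star _ _).
rewrite mulrBr !psi_star_mderiv_monomial !psi_star_monomial !mnmE.
have -> : \sum_k alpha k *+ [multinom `|pos_part (n i) ord0 l|%N | l < m] k
    = psi_pos (n i).
  by apply: eq_bigr => k _; rewrite mnmE.
have -> : \sum_k alpha k *+ [multinom `|neg_part (n i) ord0 l|%N | l < m] k
    = psi_pos (n i).
  by rewrite -psi_pos_neg; apply: eq_bigr => k _; rewrite mnmE.
rewrite !scaler_nat !pmulrn -mulrzBr; congr (_ *~ _).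
by rewrite !mxE; lia.
Qed.

(** Determinants of a matrix identity: the Jacobian block times the diagonal of the X^alpha_j equals
    the diagonal of the X^psi(n_i^+) times the block of [R]. *)
Lemma jacobian_minor k (I : 'I_k -> 'I_p) (J : 'I_k -> 'I_m) :
  X (\sum_l alpha (J l))
    * \det (mxsub I J (jacobian_mx alpha (fun i => binomial_of K (n i))))
  = (\det (mxsub I J (\matrix_i n i)))%:~R *: X (\sum_l psi_pos (n (I l))).
Proof.
rewrite !Xpow_sum scaler_int.
have diag_prod (f : 'I_k -> semialg K (subsg Lam)) :
    \prod_l f l = \det (diag_mx (\row_l f l)).
  by rewrite det_diag; apply: eq_bigr => l _; rewrite mxE.
rewrite !diag_prod mulrC -mulrzr -det_map_mx -!det_mulmx; congr (\det _).
apply/matrixP => i j; rewrite mul_mx_diag mul_diag_mx !mxE mulrC.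
have := jacobian_entry (I i) (J j); rewrite mxE => ->.
by rewrite mulrzr.
Qed.

End JacobianMinors.

(** * Admissible index pairs and nonzero minors of [R] *)

Section JacobianIndex.
Variables (d m p : nat) (M : zmodType) (phi : {additive M -> 'rV[int]_d}).
Hypothesis phi_bij : bijective phi.
Variables (a : 'I_m -> M) (n : 'I_p -> 'rV[int]_m).
Hypothesis a_span : forall x, exists c : 'I_m -> int, x = \sum_j a j *~ c j.
Hypothesis n_ker : forall i, psi a (n i) = 0.

Let A : 'M[rat]_(m, d) := map_mx intr (\matrix_j phi (a j)).

(** Each standard basis vector is an integer combination of the rows of [A], since the [a j]
    generate [M]. *)
Lemma mxrank_span : \rank A = d.
Proof.
apply/eqP; rewrite -/(row_full A) -sub1mx; apply/row_subP => i.
have [phi' phi'K phiK] := phi_bij; have [c cE] := a_span (phi' (delta_mx 0 i)).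
apply/submxP; exists (map_mx intr (\row_j c j)).
rewrite -map_mxM row1.
have -> : (\row_j c j) *m (\matrix_j phi (a j)) = delta_mx 0 i.
  rewrite -(phiK (delta_mx 0 i)) cE raddf_sum mulmx_sum_row.
  by apply: eq_bigr => j _; rewrite rowK mxE raddfMz /= -scaler_int intz.
by rewrite map_delta_mx.
Qed.

Lemma span_dim_le : (d <= m)%N.
Proof. by rewrite -mxrank_span rank_leq_row. Qed.

Lemma jac_indexP (J : 'I_d -> 'I_m) (I J' : 'I_(m - d) -> _) :
  increasing J -> increasing I -> increasing J' ->
  (forall j, (j \in codom J') = (j \notin codom J)) ->
  jac_index a n J I <-> \det (mxsub I J' (\matrix_i n i)) != 0.
Proof.
move=> JI II J'I J'E.
pose B : 'M[rat]_(m - d, m) := map_mx intr (rowsub I (\matrix_i n i)).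
(* Row [i] of this product is [phi] applied to the relation [psi a (n (I i)) = 0]. *)
have BA : B *m A = 0.
  rewrite /B /A -map_mxM -[RHS](map_mx0 (intr : int -> rat)); congr map_mx.
  apply/row_matrixP => i; rewrite row_mul row0 row_rowsub rowK.
  have := congr1 phi (n_ker (I i)); rewrite raddf0 raddf_sum mulmx_sum_row => nE.
  rewrite -[RHS]nE.
  by apply: eq_bigr => j _; rewrite rowK raddfMz /= -scaler_int intz.
have := complementary_minor_neq0 (increasing_inj JI) (increasing_inj J'I) J'E
  (subnKC span_dim_le) mxrank_span BA.
rewrite /B /A -!map_mxsub !det_map_mx !intr_eq0.
have -> : rowsub J (\matrix_j phi (a j)) = \matrix_k phi (a (J k)).
  by apply/matrixP => i j; rewrite !mxE.
have -> : colsub J' (rowsub I (\matrix_i n i)) = mxsub I J' (\matrix_i n i).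
  by apply/matrixP => i j; rewrite !mxE.
rewrite -(wedge_neq0 phi_bij) => ->.
split=> [[_ _ wJ rB]|/andP[wJ /eqP rB]]; last by split.
by rewrite wJ rB eqxx.
Qed.

End JacobianIndex.

(** * The Jacobian ideal as a monomial ideal *)

Theorem proposition1p6
  (R : realType)
  (d : nat) (M : zmodType)
  (phi : {additive M -> 'rV[int]_d}) (phi_bij : bijective phi)
  (Lam : addrClosed M)
  (Lam_span : forall x : M, Zspan (fun y => y \in Lam) x)
  (Lam_convex : strictly_convex (@cone R d M phi Lam))
  (Lam_dim : cone_has_dim (@cone R d M phi Lam) d)
  (m : nat) (alpha : 'I_m -> subsg Lam)
  (alpha_neq0 : forall j, alpha j != 0)
  (alpha_gen : forall x : subsg Lam,
     exists c : 'I_m -> nat, x = \sum_(j < m) alpha j *+ c j)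
  (p : nat) (n : 'I_p -> 'rV[int]_m)
  (n_neq0 : forall i, n i != 0)
  (n_ker : forall i, psi (fun j => val (alpha j)) (n i) = 0)
  (h_gen : forall f : {mpoly (complex R)[m]},
     ideal_gen (fun g => exists i : 'I_p, g = binomial_of (complex R) (n i)) f
     <-> @psi_star (complex R) _ m alpha f = 0) :
  (forall (J : 'I_d -> 'I_m) (I : 'I_(m - d) -> 'I_p),
     jac_index (fun j => val (alpha j)) n J I ->
     jac_exp (fun j => val (alpha j)) n J I \in Lam) /\
  (forall f : semialg (complex R) (subsg Lam),
     Jac d alpha (fun i => binomial_of (complex R) (n i)) f <->
     ideal_gen (fun g => exists (J : 'I_d -> 'I_m) (I : 'I_(m - d) -> 'I_p)
                                (lam : subsg Lam),
       [/\ jac_index (fun j => val (alpha j)) n J I,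
           val lam = jac_exp (fun j => val (alpha j)) n J I
         & g = Xpow (complex R) lam]) f).
Proof.
pose a j := val (alpha j).
have a_span x : exists c : 'I_m -> int, x = \sum_j a j *~ c j.
  have [s [sP ->]] := Lam_span x.
  rewrite big_seq; elim/big_ind: _ => [|y z [c ->] [c' ->]|t /sP tL].
  - by exists (fun=> 0); rewrite big1.
  - exists (fun j => c j + c' j); rewrite -big_split.
    by apply: eq_bigr => j _; rewrite mulrzDr.
  have [c /(congr1 val) tE] := alpha_gen (Sub t.2 tL).
  exists (fun j => (c j)%:Z * t.1); rewrite SubK in tE.
  rewrite tE raddf_sum mulrz_suml; apply: eq_bigr => j _.
  by rewrite mulrzA raddfMn.
pose jac_minor I J' := \det (mxsub I J'
  (jacobian_mx alpha (fun i => binomial_of (complex R) (n i)))).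
(* The dichotomy behind both inclusions: a Jacobian minor is 0 or a nonzero scalar times the
   monomial whose exponent is [jac_exp]. *)
have minorP (J : 'I_d -> 'I_m) (I : 'I_(m - d) -> 'I_p) J' :
    increasing J -> increasing I -> increasing J' ->
    (forall j, (j \in codom J') = (j \notin codom J)) ->
  if \det (mxsub I J' (\matrix_i n i)) == 0 then jac_minor _ I J' = 0 else
  exists lam c, [/\ val lam = jac_exp a n J I, c != 0
    & jac_minor _ I J' = c *: Xpow (complex R) lam].
  move=> JI II J'I J'E; have := jacobian_minor (complex R) n_ker I J'.
  case: eqP => [->|/eqP det0].
    by rewrite scale0r => /(XpowM_eq0 (@subsg_cancel _ _)).
  move=> /(XpowM_eq (@subsg_cancel _ _)); rewrite intr_eq0.
  move=> /(_ det0)[lam lamE gE].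
  exists lam, (\det (mxsub I J' (\matrix_i n i)))%:~R.
  split=> //; last by rewrite intr_eq0.
    rewrite /jac_exp (big_compl (increasing_inj J'I) J'E).
    apply/eqP; rewrite eq_sym subr_eq addrC; apply/eqP.
    have := congr1 val lamE; rewrite raddfD !raddf_sum /= => <-.
    by apply: eq_bigr => k _; rewrite val_psi_pos.
have indexP J I J' := @jac_indexP _ _ _ _ _ phi_bij a n a_span n_ker J I J'.
split=> [J I JI|f].
  have [Jincr Iincr _ _] := JI; have [J' J'incr J'E] := increasing_compl Jincr.
  have := minorP _ _ _ Jincr Iincr J'incr J'E.
  have /negPf -> := (indexP _ _ _ Jincr Iincr J'incr J'E).1 JI.
  by move=> [lam [_ [<- _ _]]]; apply: valP.
split; apply: ideal_gen_sub => {}f.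
  move=> [I [J' [Iincr J'incr ->]]].
  (* The complement of [J'] has [m - (m - d)] elements, which is [d] because [d <= m]. *)
  have [J Jincr J'E] : exists2 J : 'I_d -> 'I_m, increasing J
      & forall j, (j \in codom J') = (j \notin codom J).
    have := increasing_compl J'incr.
    rewrite subKn ?(span_dim_le phi_bij a_span) // => -[J Jincr JE].
    by exists J => // j; rewrite JE negbK.
  have := minorP _ _ _ Jincr Iincr J'incr J'E.
  have := indexP _ _ _ Jincr Iincr J'incr J'E.
  case: eqP => /= [_ _|_ [_ /(_ isT) JI] [lam [c [lamE _ gE]]]].
    by rewrite /jac_minor => ->; apply: ideal_gen0.
  rewrite -/(jac_minor _ _ _) gE -mulr_algl; apply: ideal_gen_mull.
  by exists J, I, lam.
move=> [J [I [lam [JI lamE ->]]]].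
have [Jincr Iincr _ _] := JI; have [J' J'incr J'E] := increasing_compl Jincr.
have := minorP _ _ _ Jincr Iincr J'incr J'E.
have /negPf -> := (indexP _ _ _ Jincr Iincr J'incr J'E).1 JI.
move=> [lam' [c [lam'E c0 gE]]].
(* The nonzero scalar [c] is inverted in the field, and [lam = lam'] as both have the same image in
   [M]. *)
have -> : Xpow (complex R) lam = c^-1%:A * jac_minor _ I J'.
  rewrite mulr_algl gE scalerA mulVf // scale1r; congr Xpow.
  by apply: val_inj; rewrite lamE lam'E.
by apply: ideal_gen_mull; exists I, J'.
Qed.
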